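(* Let $k,d,T\ge1$, let $\mathcal K_1,\dots,\mathcal K_k\subseteq\mathbb R^d$ be nonempty convex sets, and let $\mathcal K=\mathcal K_1\times\dots\times\mathcal K_k$. For each $i\in\{1,\dots,k\}$ let $\mathcal A_i$ be an online convex optimization algorithm over $\mathcal K_i$, and suppose that $\mathcal A_i$ has (average) regret $\mathcal R_T(\mathcal A_i)$ over $\mathcal K_i$ on the linear loss functions $\langle g^i_t,\cdot\rangle$, $g^i_t=\nabla\ell^i_t(x^i_t)$, provided to it by the Multiplayer OCO procedure described in the context. Then the average multi-agent regret of the Multiplayer OCO procedure satisfies $$\mathcal R_T(\mathcal A_{1:k})\le\sum_{i=1}^k\mathcal R_T(\mathcal A_i).$$
   Context: Multiplayer online convex optimization (OCO). There are $k$ players and $T$ rounds. In round $t$, player $i$ commits to a decision $x^i_t\in\mathcal K_i$; the joint decision is $x_t=(x^1_t,\dots,x^k_t)\in\mathcal K$. Then a convex differentiable loss $\ell_t:\mathcal K\to\mathbb R$ is incurred at $x_t$, and player $i$ observes $\ell^i_t:\mathcal K_i\to\mathbb R$, $\ell^i_t(x)=\ell_t(x^1_t,\dots,x^{i-1}_t,x,x^{i+1}_t,\dots,x^k_t)$. OCO algorithm. An OCO algorithm $\mathcal A_i$ over $\mathcal K_i$ is a rule that at each round $t$ outputs a point of $\mathcal K_i$ as a function of the loss functions fed to it in rounds $1,\dots,t-1$. Multiplayer OCO procedure. In each round $t=1,\dots,T$, for each player $i$: $\mathcal A_i$ predicts $x^i_t$; compute $g^i_t=\nabla\ell^i_t(x^i_t)$;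 feed $\mathcal A_i$ the linear loss function $\langle g^i_t,\cdot\rangle$. Regret. Let $\mathfrak L$ be the (nonempty, otherwise arbitrary) class of admissible loss sequences $(\ell_1,\dots,\ell_T)$ of convex differentiable functions on $\mathcal K$. Running the Multiplayer OCO procedure on such a sequence determines the $x^i_t$ and $g^i_t$. The average multi-agent regret is $$\mathcal R_T(\mathcal A_{1:k})=\sup_{(\ell_1,\dots,\ell_T)\in\mathfrak L}\Big\{\frac1T\sum_{t=1}^T\ell_t(x_t)-\inf_{x^*\in\mathcal K}\frac1T\sum_{t=1}^T\ell_t(x^* )\Big\},$$ and the regret of $\mathcal A_i$ on the induced linear losses is $$\mathcal R_T(\mathcal A_i)=\sup_{(\ell_1,\dots,\ell_T)\in\mathfrak L}\Big\{\frac1T\sum_{t=1}^T\langle g^i_t,x^i_t\rangle-\inf_{x\in\mathcal K_i}\frac1T\sum_{t=1}^T\langle g^i_t,x\rangle\Big\}.$$ These quantities take values in $(-\infty,+\infty]$. *)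

(* Defs.v *)
From HB Require Import structures.
From mathcomp Require Import all_boot all_order all_algebra.
From mathcomp Require Import all_classical all_reals all_analysis.

Set Implicit Arguments.
Unset Strict Implicit.
Unset Printing Implicit Defensive.

Import Order.TTheory GRing.Theory Num.Theory.
Import numFieldNormedType.Exports.

Local Open Scope classical_set_scope.
Local Open Scope ring_scope.

(* Points of R^d are row vectors; a joint decision (x^1, ..., x^k) of the
   players is the k x d matrix whose i-th row is x^i.  A function on a subset S
   of such a space is represented by a total function, and only its values on
   S enter the notions below. *)

(* Euclidean inner product of R^(m x n); for m = 1, that of R^n. *)
Definition inner (R : realType) (m n : nat) (u v : 'M[R]_(m, n)) : R :=
  \sum_i \sum_j u i j * v i j.

(* Differentiability is relative to S, so that it makes sense at boundary
   points and for sets with empty interior: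
     f y = f x + <g, y - x> + o(y - x)   as y tends to x within S.
   Where S does not determine g, every such g counts as a gradient; the usual
   gradient of a function differentiable in a neighbourhood of x is one. *)
Definition is_gradient_on (R : realType) (m n : nat) (S : set 'M[R]_(m, n))
    (f : 'M[R]_(m, n) -> R) (x g : 'M[R]_(m, n)) : Prop :=
  forall y, (f y : R^o) = (f x + inner g (y - x) : R^o)
    +o_(y \near within S (nbhs x)) (y - x).

Definition differentiable_on (R : realType) (m n : nat)
    (S : set 'M[R]_(m, n)) (f : 'M[R]_(m, n) -> R) : Prop :=
  forall x, S x -> exists g, is_gradient_on S f x g.

(* A way of evaluating nabla f (x) for functions f differentiable on S. *)
Definition is_nabla_on (R : realType) (m n : nat) (S : set 'M[R]_(m, n))
    (nabla : ('M[R]_(m, n) -> R) -> 'M[R]_(m, n) -> 'M[R]_(m, n)) : Prop :=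
  forall f, differentiable_on S f ->
  forall x, S x -> is_gradient_on S f x (nabla f x).

Record oco_algorithm (R : realType) (d : nat) (S : set 'rV[R]_d) :=
  OCOAlgorithm {
    predict :> seq ('rV[R]_d -> R) -> 'rV[R]_d ;
    predict_in : forall fed, S (predict fed) }.

Definition joint_domain (R : realType) (k d : nat) (K : 'I_k -> set 'rV[R]_d) :
    set 'M[R]_(k, d) :=
  [set X | forall i, K i (row i X)].

Definition joint_loss (R : realType) (k d : nat) : Type := 'M[R]_(k, d) -> R.

(* y |-> l(x^1, ..., x^(i-1), y, x^(i+1), ..., x^k) *)
Definition player_loss (R : realType) (k d : nat) (l : joint_loss R k d)
    (X : 'M[R]_(k, d)) (i : 'I_k) : 'rV[R]_d -> R :=
  fun y => l (\matrix_(j < k) if j == i then y else row j X).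

Section Procedure.
Context (R : realType) (k d : nat) (K : 'I_k -> set 'rV[R]_d).
Context (nabla : 'I_k -> ('rV[R]_d -> R) -> 'rV[R]_d -> 'rV[R]_d).
Context (A : forall i, oco_algorithm (K i)).

Definition joint_prediction (fed : 'I_k -> seq ('rV[R]_d -> R)) :
    'M[R]_(k, d) :=
  \matrix_(i < k) A i (fed i).

Definition partial_gradient (l : joint_loss R k d) (X : 'M[R]_(k, d))
    (i : 'I_k) : 'rV[R]_d :=
  nabla i (player_loss l X i) (row i X).

Definition play_round (fed : 'I_k -> seq ('rV[R]_d -> R))
    (l : joint_loss R k d) : 'I_k -> seq ('rV[R]_d -> R) :=
  fun i => rcons (fed i) (inner (partial_gradient l (joint_prediction fed) i)).

(* x_t and g^i_t, with rounds numbered from 0 *)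
Definition decision (T : nat) (ls : T.-tuple (joint_loss R k d)) (t : 'I_T) :
    'M[R]_(k, d) :=
  joint_prediction (foldl play_round (fun=> [::]) (take t ls)).

Definition round_gradient (T : nat) (ls : T.-tuple (joint_loss R k d))
    (i : 'I_k) (t : 'I_T) : 'rV[R]_d :=
  partial_gradient (tnth ls t) (decision ls t) i.

Definition average (T : nat) (a : 'I_T -> R) : R := T%:R^-1 * \sum_(t < T) a t.

Definition regret_against (V : Type) (S : set V) (T : nat)
    (f : 'I_T -> V -> R) (x : 'I_T -> V) : \bar R :=
  ((average (fun t => f t (x t)))%:E
   - ereal_inf [set (average (fun t => f t y))%:E | y in S])%E.

Definition multi_agent_regret (T : nat)
    (admissible : set (T.-tuple (joint_loss R k d))) : \bar R :=
  ereal_sup [set regret_against (joint_domain K) (tnth ls) (decision ls)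
            | ls in admissible].

Definition player_regret (T : nat)
    (admissible : set (T.-tuple (joint_loss R k d))) (i : 'I_k) : \bar R :=
  ereal_sup [set regret_against (K i)
                   (fun t => inner (round_gradient ls i t))
                   (fun t => row i (decision ls t))
            | ls in admissible].

End Procedure.

(* Main.v *)
Require Import Defs.
From HB Require Import structures.
From mathcomp Require Import all_boot all_order all_algebra.
From mathcomp Require Import all_classical all_reals all_analysis.

(* A gradient G of l_t at x_t satisfies
   l_t(x_t) - l_t(y) <= <G, x_t - y> = \sum_i <G_i, x^i_t - y^i> by convexity, and
   the i-th row G_i of G is a gradient of the i-th player's loss at x^i_t.  The
   gradient g^i_t fed to A_i may differ from G_i, but both compute the same
   directional derivatives into K_i, so G_i may be replaced by g^i_t.  Since y
   ranges over a product, averaging over t bounds the joint regret by the sum of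
   the individual regrets for each loss sequence, and then for the suprema. *)

Set Implicit Arguments.
Unset Strict Implicit.
Unset Printing Implicit Defensive.

Import Order.TTheory GRing.Theory Num.Theory.
Import numFieldNormedType.Exports.

Local Open Scope classical_set_scope.
Local Open Scope ring_scope.

(** * Gradients relative to a convex set *)

(** The little-o of [is_gradient_on] is written pointwise in [y]; by extensionality it is an
    identity of functions, which has an epsilon form. *)
Lemma is_gradient_onP (R : realType) (m n : nat) (S : set 'M[R]_(m, n))
    (f : 'M[R]_(m, n) -> R) (x g : 'M[R]_(m, n)) :
  is_gradient_on S f x g <->
  forall e, 0 < e -> \forall y \near nbhs x,
    S y -> `|f y - (f x + inner g (y - x))| <= e * `|y - x|.
Proof.
have P := @eqaddoP R _ R^o 'M[R]_(m, n) (within_filter_on S (nbhs_filter_on x))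
  f (fun y => f x + inner g (y - x)) (fun y => y - x).
split.
- by move=> H; apply/P; apply/funext.
- by move=> /P H y; rewrite [LHS](congr1 (fun h => h y) H).
Qed.

Lemma innerDr (R : realType) (m n : nat) (g u v : 'M[R]_(m, n)) :
  inner g (u + v) = inner g u + inner g v.
Proof.
rewrite /inner -big_split; apply: eq_bigr => i _.
by rewrite -big_split; apply: eq_bigr => j _; rewrite mxE mulrDr.
Qed.

Lemma innerZr (R : realType) (m n : nat) (a : R) (g v : 'M[R]_(m, n)) :
  inner g (a *: v) = a * inner g v.
Proof.
rewrite /inner mulr_sumr; apply: eq_bigr => i _.
by rewrite mulr_sumr; apply: eq_bigr => j _; rewrite mxE mulrCA.
Qed.

Lemma innerBr (R : realType) (m n : nat) (g u v : 'M[R]_(m, n)) :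
  inner g (u - v) = inner g u - inner g v.
Proof. by rewrite innerDr -scaleN1r innerZr mulN1r. Qed.

Lemma inner_rows (R : realType) (m n : nat) (g v : 'M[R]_(m, n)) :
  inner g v = \sum_i inner (row i g) (row i v).
Proof.
apply: eq_bigr => i _; rewrite /inner big_ord1.
by apply: eq_bigr => j _; rewrite !mxE.
Qed.

(** [conv] puts its weight on the first point, so [y] comes first for [s] to measure the way from
    [x] to [y]. *)
Lemma conv_segment (R : realType) (E : lmodType R) (x y : E) (s : R)
    (s0 : 0 <= s) (s1 : s <= 1) :
  conv (Itv01 s0 s1) (y : convex_lmodType E) x = x + s *: (y - x).
Proof.
by rewrite /conv /= /unstable.onem scalerBl scale1r scalerBr addrCA.
Qed.

Lemma convex_set_segment (R : realType) (m n : nat) (S : set 'M[R]_(m, n))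
    (x y : 'M[R]_(m, n)) (s : R) :
  convex_set S -> S x -> S y -> 0 <= s -> s <= 1 -> S (x + s *: (y - x)).
Proof.
move=> cS Sx Sy s0 s1.
have := cS y x (Itv01 s0 s1) (mem_set Sy) (mem_set Sx).
by rewrite inE conv_segment.
Qed.

(** At [x + s *: v] the remainder is at most a small multiple of [s * |v|], and dividing by [s]
    keeps it small. Only [s > 0] is used, since [S] may end at [x]. *)
Lemma gradient_directional (R : realType) (m n : nat) (S : set 'M[R]_(m, n))
    (f : 'M[R]_(m, n) -> R) (x g v : 'M[R]_(m, n)) :
  (forall s, 0 < s -> s <= 1 -> S (x + s *: v)) ->
  is_gradient_on S f x g ->
  s^-1 * (f (x + s *: v) - f x) @[s --> 0^'+] --> (inner g v : R).
Proof.
move=> Sv /is_gradient_onP fg; apply/cvgrPdist_le => e e0.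
(* The added 1 allows division when [v] is 0. *)
have v0 : 0 < `|v| + 1 by rewrite ltr_wpDl.
have xv : x + s *: v @[s --> 0^'+] --> x.
  have -> : nbhs x = nbhs (x + 0 *: v) by rewrite scale0r addr0.
  apply: cvgD; first exact: cvg_cst.
  apply: cvgZr_tmp; exact: cvg_at_right_filter cvg_id.
have nfg : \forall s \near 0^'+, S (x + s *: v) ->
    `|f (x + s *: v) - (f x + inner g (x + s *: v - x))|
      <= e / (`|v| + 1) * `|x + s *: v - x| := xv _ (fg _ (divr_gt0 e0 v0)).
near=> s.
have s0 : 0 < s by near: s; exact: nbhs_right_gt.
have s1 : s <= 1 by near: s; exact: nbhs_right_le.
have : S (x + s *: v) -> `|f (x + s *: v) - (f x + inner g (x + s *: v - x))|
    <= e / (`|v| + 1) * `|x + s *: v - x| by near: s.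
move=> /(_ (Sv _ s0 s1)).
set a := inner g v; rewrite [x + _]addrC addrK innerZr => fs.
have -> : a - s^-1 * (f (s *: v + x) - f x)
    = - (s^-1 * (f (s *: v + x) - (f x + s * a))).
  by rewrite opprD addrA [in RHS]mulrBr mulKf ?gt_eqF// opprB.
rewrite normrN normrM gtr0_norm ?invr_gt0// ler_pdivrMl// (le_trans fs)//.
rewrite normrZ gtr0_norm// mulrCA ler_pM2l// -mulrA ler_piMr ?(ltW e0)//.
by rewrite mulrC ler_pdivrMr// mul1r lerDl.
Unshelve. all: by end_near. Qed.

(* The gradient itself need not be unique, e.g. when S has empty interior. *)
Lemma gradient_inner_unique (R : realType) (m n : nat) (S : set 'M[R]_(m, n))
    (f : 'M[R]_(m, n) -> R) (x y g g' : 'M[R]_(m, n)) :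
  convex_set S -> S x -> S y ->
  is_gradient_on S f x g -> is_gradient_on S f x g' ->
  inner g (y - x) = inner g' (y - x).
Proof.
move=> cS Sx Sy fg fg'.
have Sv s : 0 < s -> s <= 1 -> S (x + s *: (y - x)).
  by move=> /ltW s0 s1; exact: convex_set_segment.
(* Both inner products are limits of the same difference quotient. *)
apply: cvg_unique (gradient_directional Sv fg) (gradient_directional Sv fg').
exact: norm_hausdorff.
Qed.

(** By convexity the difference quotients along the segment from [x] to [y] never exceed
    [f y - f x]; their limit at 0 inherits the bound. *)
Lemma convex_gradient_le (R : realType) (m n : nat) (S : set 'M[R]_(m, n))
    (f : 'M[R]_(m, n) -> R) (x y g : 'M[R]_(m, n)) :
  convex_set S -> convex_function S f -> S x -> S y ->
  is_gradient_on S f x g -> inner g (y - x) <= f y - f x.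
Proof.
move=> cS cf Sx Sy fg.
have Sv s : 0 < s -> s <= 1 -> S (x + s *: (y - x)).
  by move=> /ltW s0 s1; exact: convex_set_segment.
have lim := gradient_directional Sv fg.
rewrite -(cvg_lim _ lim)//; apply: limr_le.
  by apply/cvg_ex; eexists; exact: lim.
near=> s.
have s0 : 0 < s by near: s; exact: nbhs_right_gt.
have s1 : s <= 1 by near: s; exact: nbhs_right_le.
rewrite ler_pdivrMl//.
have := cf (Itv01 (ltW s0) s1) y x (mem_set Sy) (mem_set Sx).
rewrite conv_segment lerBlDl => /le_trans; apply.
by rewrite [leLHS](@conv_segment R R^o (f x) (f y) s (ltW s0) s1).
Unshelve. all: by end_near. Qed.

(** * Moves of a single player and the linearized joint loss *)

Definition row_embedding (R : realType) (k d : nat) (i : 'I_k) (v : 'rV[R]_d) :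
    'M[R]_(k, d) :=
  \matrix_(j < k) if j == i then v else 0.

(** The argument inside [player_loss]: [player_loss l X i y] is convertible to
    [l (set_row X i y)]. *)
Definition set_row (R : realType) (k d : nat) (X : 'M[R]_(k, d)) (i : 'I_k)
    (y : 'rV[R]_d) : 'M[R]_(k, d) :=
  \matrix_(j < k) if j == i then y else row j X.

Lemma set_rowB (R : realType) (k d : nat) (X : 'M[R]_(k, d)) (i : 'I_k)
    (y z : 'rV[R]_d) :
  set_row X i y - set_row X i z = row_embedding i (y - z).
Proof.
apply/matrixP => j l; rewrite !mxE.
by case: ifP => _; rewrite !mxE ?subrr.
Qed.

(** The norm is the largest absolute value of an entry, and the added rows vanish. *)
Lemma norm_row_embedding (R : realType) (k d : nat) (i : 'I_k) (v : 'rV[R]_d) :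
  `|row_embedding i v| <= `|v|.
Proof.
rewrite /Num.norm/= !mx_normrE; apply: bigmax_le => [|[j l] _ /=].
  exact: bigmax_ge_id.
rewrite mxE; case: ifP => _; last first.
  by rewrite mxE normr0; apply: bigmax_ge_id.
by apply: (le_bigmax _ (fun p => `|v p.1 p.2|) (0, l)).
Qed.

Lemma inner_row_embedding (R : realType) (k d : nat) (g : 'M[R]_(k, d))
    (i : 'I_k) (v : 'rV[R]_d) :
  inner g (row_embedding i v) = inner (row i g) v.
Proof.
rewrite inner_rows (bigD1 i)//= rowK eqxx big1 ?addr0// => j /negbTE ji.
by rewrite rowK ji /inner big1// => ? _; rewrite big1// => ? _; rewrite !mxE mulr0.
Qed.

Lemma joint_domain_set_row (R : realType) (k d : nat)
    (K : 'I_k -> set 'rV[R]_d) (X : 'M[R]_(k, d)) (i : 'I_k) (y : 'rV[R]_d) :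
  joint_domain K X -> K i y -> joint_domain K (set_row X i y).
Proof. by move=> KX Ky j; rewrite rowK; case: eqP => [->|]. Qed.

Lemma convex_joint_domain (R : realType) (k d : nat)
    (K : 'I_k -> set 'rV[R]_d) :
  (forall i, convex_set (K i)) -> convex_set (joint_domain K).
Proof.
move=> cK X Y t; rewrite !inE => KX KY i.
have := cK i (row i X) (row i Y) t (mem_set (KX i)) (mem_set (KY i)).
rewrite inE; congr (K i _).
by rewrite /conv /= linearD !linearZ.
Qed.

(** The remainder estimate for [l] restricts to the slice where only row [i] moves: the embedding of
    that row does not increase norms, so the same radius works, and [inner G] sees only row [i] of
    [G]. *)
Lemma player_loss_gradient (R : realType) (k d : nat)
    (K : 'I_k -> set 'rV[R]_d) (l : joint_loss R k d) (X : 'M[R]_(k, d))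
    (i : 'I_k) (y : 'rV[R]_d) (G : 'M[R]_(k, d)) :
  joint_domain K X ->
  is_gradient_on (joint_domain K) l (set_row X i y) G ->
  is_gradient_on (K i) (player_loss l X i) y (row i G).
Proof.
move=> KX /is_gradient_onP lG; apply/is_gradient_onP => e e0.
have /nbhs_ballP[r /= r0] := lG e e0; rewrite -ball_normE => rP.
apply/nbhs_ballP; exists r => //; rewrite -ball_normE => z /= yz Kz.
have yz' : `|set_row X i y - set_row X i z| < r.
  by rewrite set_rowB (le_lt_trans (norm_row_embedding _ _)).
have := rP _ yz' (joint_domain_set_row KX Kz).
rewrite set_rowB inner_row_embedding => /le_trans; apply.
by rewrite ler_pM2l//; exact: norm_row_embedding.
Qed.

Lemma joint_loss_le_partial_gradients (R : realType) (k d : nat)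
    (K : 'I_k -> set 'rV[R]_d)
    (nabla : 'I_k -> ('rV[R]_d -> R) -> 'rV[R]_d -> 'rV[R]_d)
    (l : joint_loss R k d) (X Y : 'M[R]_(k, d)) :
  (forall i, convex_set (K i)) ->
  (forall i, is_nabla_on (K i) (nabla i)) ->
  convex_function (joint_domain K) l ->
  differentiable_on (joint_domain K) l ->
  joint_domain K X -> joint_domain K Y ->
  l X - l Y <= \sum_(i < k) (inner (partial_gradient nabla l X i) (row i X)
                             - inner (partial_gradient nabla l X i) (row i Y)).
Proof.
move=> cK nablaP cl dl KX KY.
have [G lG] := dl _ KX.
have := convex_gradient_le (convex_joint_domain cK) cl KX KY lG.
rewrite -lerN2 opprB => /le_trans; apply.
rewrite inner_rows -sumrN; apply: ler_sum => i _.
have setX : set_row X i (row i X) = X.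
  by apply/row_matrixP => j; rewrite rowK; case: eqP => [->|].
have lGi : is_gradient_on (K i) (player_loss l X i) (row i X) (row i G).
  by apply: (player_loss_gradient KX); rewrite setX.
(* [is_nabla_on] speaks only of functions differentiable on all of [K i], so a gradient is needed at
   every point [y], not just at row [i] of [X]. *)
have dli : differentiable_on (K i) (player_loss l X i).
  move=> y Ky; have [H lH] := dl _ (joint_domain_set_row KX Ky).
  by exists (row i H); exact: (player_loss_gradient KX lH).
rewrite linearB /=.
have gi := nablaP i _ dli _ (KX i).
rewrite (gradient_inner_unique (cK i) (KX i) (KY i) lGi gi).
by rewrite innerBr opprB.
Qed.

(** * From losses to regrets *)

Lemma averageB (R : realType) (T : nat) (a b : 'I_T -> R) :
  average a - average b = T%:R^-1 * \sum_(t < T) (a t - b t).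
Proof. by rewrite -mulrBr sumrB. Qed.

Lemma regret_against_ge (R : realType) (V : Type) (S : set V) (T : nat)
    (f : 'I_T -> V -> R) (x : 'I_T -> V) (y : V) :
  S y ->
  ((average (fun t => f t (x t)) - average (fun t => f t y))%:E
    <= regret_against S f x)%E.
Proof.
by move=> Sy; rewrite EFinB leeB//; apply: ereal_inf_lbound; exists y.
Qed.

(** Since [r] is real, the hypothesis rearranges to a lower bound [a - r] on the competitors'
    averages, hence on their infimum. *)
Lemma regret_against_le (R : realType) (V : Type) (S : set V) (T : nat)
    (f : 'I_T -> V -> R) (x : 'I_T -> V) (r : R) :
  (forall y, S y ->
    average (fun t => f t (x t)) - average (fun t => f t y) <= r) ->
  (regret_against S f x <= r%:E)%E.
Proof.
move=> xr; set a := average _ in xr *.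
have /(leeB (lexx a%:E)) : ((a - r)%:E
    <= ereal_inf [set (average (fun t => f t y))%:E | y in S])%E.
  apply: le_ereal_inf_tmp => _ [y Sy <-].
  by rewrite lee_fin lerBlDl -lerBlDr xr.
by rewrite -EFinB subKr.
Qed.

(** Each row of a joint competitor [Y] is itself a competitor in the regret of its player, so the
    bound can be checked one [Y] at a time once the right-hand side is known to be real. *)
Lemma regret_against_le_sum (R : realType) (k d T : nat)
    (K : 'I_k -> set 'rV[R]_d) (f : 'I_T -> 'M[R]_(k, d) -> R)
    (h : 'I_k -> 'I_T -> 'rV[R]_d -> R) (X : 'I_T -> 'M[R]_(k, d)) :
  (forall i, K i !=set0) ->
  (forall t Y, joint_domain K Y ->
    f t (X t) - f t Y <= \sum_i (h i t (row i (X t)) - h i t (row i Y))) ->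
  (regret_against (joint_domain K) f X
    <= \sum_i regret_against (K i) (h i) (fun t => row i (X t)))%E.
Proof.
move=> K0 fh; pose r i := regret_against (K i) (h i) (fun t => row i (X t)).
rewrite -[leRHS]/(\sum_i r i)%E.
have rNy i : r i != -oo%E.
  have [y Ky] := K0 i.
  (* The gap to a single competitor [y] is a real lower bound. *)
  by rewrite -ltNye (lt_le_trans (ltNyr _) (regret_against_ge _ _ Ky)).
(* As no r i is -oo, the sum is +oo as soon as one of its terms is. *)
have [/eqP->|] := boolP (\sum_i r i == +oo)%E; first exact: leey.
rewrite esum_eqy// negb_exists => /forallP rNoo.
have rE i : r i = (fine (r i))%:E.
  by rewrite fineK// fin_numE rNy; exact: rNoo.
rewrite (eq_bigr _ (fun i _ => rE i)) sumEFin.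
apply: regret_against_le => Y KY.
apply: (@le_trans _ _ (\sum_i (average (fun t => h i t (row i (X t)))
                               - average (fun t => h i t (row i Y))))).
  (* Exchanging the sums over players and rounds reduces the claim to the hypothesis in each
     round. *)
  under eq_bigr do rewrite averageB.
  rewrite averageB -mulr_sumr exchange_big ler_wpM2l ?invr_ge0//.
  by apply: ler_sum => t _; exact: fh.
apply: ler_sum => i _; rewrite -lee_fin -rE.
exact: (@regret_against_ge _ _ _ _ (h i) (fun t => row i (X t)) _ (KY i)).
Qed.

Theorem theorem3p1 (R : realType) (k d T : nat)
    (hk : (0 < k)%N) (hd : (0 < d)%N) (hT : (0 < T)%N)
    (K : 'I_k -> set 'rV[R]_d)
    (K_neq0 : forall i, K i !=set0)
    (K_convex : forall i, convex_set (K i))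
    (nabla : 'I_k -> ('rV[R]_d -> R) -> 'rV[R]_d -> 'rV[R]_d)
    (nablaP : forall i, is_nabla_on (K i) (nabla i))
    (A : forall i, oco_algorithm (K i))
    (admissible : set (T.-tuple (joint_loss R k d)))
    (admissible_neq0 : admissible !=set0)
    (admissible_convex : forall ls, admissible ls -> forall t : 'I_T,
       convex_function (joint_domain K) (tnth ls t))
    (admissible_differentiable : forall ls, admissible ls -> forall t : 'I_T,
       differentiable_on (joint_domain K) (tnth ls t)) :
  (multi_agent_regret nabla A admissible
   <= \sum_(i < k) player_regret nabla A admissible i)%E.
Proof.
apply: ge_ereal_sup => _ [ls als <-].
(* The loss sequence stays fixed while regrets are compared; afterwards each summand is bounded by
   its own supremum. *)
apply: (@le_trans _ _ (\sum_(i < k) regret_against (K i)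
    (fun t => inner (round_gradient nabla A ls i t))
    (fun t => row i (decision nabla A ls t)))%E); last first.
  by apply: lee_sum => i _; apply: ereal_sup_ubound; exists ls.
apply: regret_against_le_sum => // t Y KY.
apply: joint_loss_le_partial_gradients => //.
- exact: admissible_convex.
- exact: admissible_differentiable.
- by move=> i; rewrite rowK; exact: predict_in.
Qed.
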